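(* Let $s\in\{+,-\}$, let $x,z\in\mathbb{C}$ satisfy $x^2+z^2-z=0$ if $s=+$ and $x^2+z^2+z=0$ if $s=-$, let $\overline{P}\in1\oplus\mathcal{P}_3$, and let $A$ be any one of the matrices $$\overline{P}M^{s}_{x,z},\ \ \overline{P}N^{s}_{z,x},\ \ \overline{P}P_{(23)}M^{s}_{x,z}P_{(23)},\ \ \overline{P}P_{(23)}N^{s}_{z,x}P_{(23)},\ \ \overline{P}P_{(24)}M^{s}_{x,z}P_{(24)},\ \ \overline{P}P_{(24)}N^{s}_{z,x}P_{(24)}.$$ Then $A$ is a real orthogonal permutative matrix if and only if - $z$ is real with $0\le z\le1$ and $x=\pm\sqrt{z(1-z)}$, in the case $s=+$; - $z$ is real with $-1\le z\le0$ and $x=\pm\sqrt{-z(1+z)}$, in the case $s=-$.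
   Context: $\mathcal{P}_n$ is the group of $n\times n$ permutation matrices; for a permutation $\sigma$, $P_\sigma$ has $(i,j)$ entry $1$ if $\sigma(i)=j$ and $0$ otherwise. $1\oplus\mathcal{P}_3=\left\{\begin{bmatrix}1&\mathbf{0}^T\\ \mathbf{0}&P\end{bmatrix}: P\in\mathcal{P}_3\right\}$. A matrix is permutative if each of its rows is a permutation of any other row; it is orthogonal if $A^TA=I$. For complex $t,x,z$ and a sign $\pm$: $$A_t=\begin{bmatrix}t&-t\\-t&t\end{bmatrix},\quad B^{\pm}_t=\begin{bmatrix}t&\pm1-t\\ \pm1-t&t\end{bmatrix},\quad F=\begin{bmatrix}0&1\\1&0\end{bmatrix},$$ $$M^{\pm}_{x,z}=\begin{bmatrix}A_x&B^{\pm}_z\\ B^{\pm}_z&-A_x\end{bmatrix},\quad N^{\pm}_{z,x}=\begin{bmatrix}B^{\pm}_z&A_x\\ A_x&FB^{\pm}_z\end{bmatrix}.$$ *)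

(* Defs.v *)
From HB Require Import structures.
From mathcomp Require Import all_boot all_order all_algebra all_fingroup.
From mathcomp Require Import reals.
From mathcomp Require Import complex.

Set Implicit Arguments.
Unset Strict Implicit.
Unset Printing Implicit Defensive.

Import Order.TTheory GRing.Theory Num.Theory.
Local Open Scope ring_scope.

Definition permutative (T : Type) (m n : nat) (A : 'M[T]_(m, n)) : Prop :=
  forall i j : 'I_m, exists p : 'S_n, row i A = col_perm p (row j A).

Definition orthogonal_mx (K : nzRingType) (n : nat) (A : 'M[K]_n) : Prop :=
  A^T *m A = 1%:M.

Definition real_mx (C : numDomainType) (m n : nat) (A : 'M[C]_(m, n)) : Prop :=
  forall (i : 'I_m) (j : 'I_n), A i j \is Num.real.

Definition one_oplus_P3 (K : nzRingType) (Q : 'M[K]_4) : Prop :=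
  exists2 P : 'M[K]_3, is_perm_mx P & Q = block_mx 1 0 0 P :> 'M_(1 + 3).

(* [perm_mx p] has (i, j) entry 1 exactly when p i = j. The indices of 'I_4
   start at 0, so the transpositions (2 3) and (2 4) of {1, 2, 3, 4} become
   (1 2) and (1 3). *)
Definition P23 (K : nzRingType) : 'M[K]_4 :=
  perm_mx (tperm (inord 1) (inord 2)).
Definition P24 (K : nzRingType) : 'M[K]_4 :=
  perm_mx (tperm (inord 1) (inord 3)).

Variant sign := Plus | Minus.

Definition sign_val (K : nzRingType) (s : sign) : K :=
  match s with Plus => 1 | Minus => -1 end.

Definition mxA (K : nzRingType) (t : K) : 'M[K]_2 :=
  \matrix_(i < 2, j < 2) if i == j then t else - t.

Definition mxB (K : nzRingType) (s : sign) (t : K) : 'M[K]_2 :=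
  \matrix_(i < 2, j < 2) if i == j then t else sign_val K s - t.

Definition mxF (K : nzRingType) : 'M[K]_2 :=
  \matrix_(i < 2, j < 2) if i == j then 0 else 1.

Definition mxM (K : nzRingType) (s : sign) (x z : K) : 'M[K]_4 :=
  block_mx (mxA x) (mxB s z)
           (mxB s z) (- mxA x) : 'M_(2 + 2).

Definition mxN (K : nzRingType) (s : sign) (z x : K) : 'M[K]_4 :=
  block_mx (mxB s z) (mxA x)
           (mxA x) (mxF K *m mxB s z) : 'M_(2 + 2).

(* Main.v *)
(* Multiplying by permutation matrices on either side preserves reality,
   orthogonality and permutativity, so only [M] and [N] matter. The relation
   [x^2 + z^2 = +-z] alone makes both orthogonal and permutative; they are real
   iff [x] and [z] are, and for real [x] the same relation reads
   [x^2 = z(+-1 - z)], whose right-hand side must be nonnegative. *)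

Require Import Defs.
From HB Require Import structures.
From mathcomp Require Import all_boot all_order all_algebra all_fingroup.
From mathcomp Require Import reals.
From mathcomp Require Import complex.
From mathcomp Require Import ring lra zify.

Set Implicit Arguments.
Unset Strict Implicit.
Unset Printing Implicit Defensive.

Import Order.TTheory GRing.Theory Num.Theory.
Local Open Scope ring_scope.
Local Open Scope complex_scope.

(** Row [i] of [perm_mx p] picks row [p i] of [B], while column [j] of [perm_mx q] has its 1 in row
    [q^-1 j]; hence only one inverse. *)
Lemma perm_mulmx_permE (K : nzRingType) (n : nat) (p q : 'S_n) (B : 'M[K]_n)
    (i j : 'I_n) :
  (perm_mx p *m B *m perm_mx q) i j = B (p i) ((q^-1)%g j).
Proof. by rewrite -row_permE -[q in perm_mx q]invgK -col_permE !mxE. Qed.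

Lemma real_mx_perm (C : numDomainType) (n : nat) (p q : 'S_n) (B : 'M[C]_n) :
  real_mx (perm_mx p *m B *m perm_mx q) <-> real_mx B.
Proof.
split=> realB i j; last by rewrite perm_mulmx_permE.
by have := realB ((p^-1)%g i) (q j); rewrite perm_mulmx_permE permKV permK.
Qed.

Lemma orthogonal_mx_perm (K : comNzRingType) (n : nat) (p q : 'S_n)
    (B : 'M[K]_n) :
  orthogonal_mx B -> orthogonal_mx (perm_mx p *m B *m perm_mx q).
Proof.
rewrite /orthogonal_mx => orthB; rewrite !trmx_mul !tr_perm_mx !mulmxA.
rewrite -[_ *m perm_mx p^-1 *m _]mulmxA -perm_mxM mulVg perm_mx1 mulmx1.
by rewrite -[_ *m B^T *m B]mulmxA orthB mulmx1 -perm_mxM mulVg perm_mx1.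
Qed.

Lemma permutative_perm (K : nzRingType) (n : nat) (p q : 'S_n) (B : 'M[K]_n) :
  permutative B -> permutative (perm_mx p *m B *m perm_mx q).
Proof.
move=> permB i j; have [t rowE] := permB (p i) (p j).
(* Moving the columns by [q] conjugates the permutation [t] that relates rows [p i] and [p j] of
   [B]. *)
exists (q^-1 * t * q)%g; apply/rowP => k.
have /rowP /(_ ((q^-1)%g k)) := rowE.
rewrite -row_permE -[q in perm_mx q]invgK -col_permE !mxE => ->.
by rewrite !permM permK.
Qed.

(** Reduces permutativity to equality of rows as multisets, which explicit rows allow to be checked
    by counting. *)
Lemma permutative_perm_eq (T : eqType) (m n : nat) (A : 'M[T]_(m, n)) :
  (forall i j, perm_eq [seq A i k | k <- enum 'I_n]
                       [seq A j k | k <- enum 'I_n]) ->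
  permutative A.
Proof.
move=> permA i j; have := permA i j.
move=> /(tuple_permP (t := [tuple A j k | k < n])) [p rowE].
exists p; apply/rowP => k; rewrite !mxE.
have := congr1 (fun s => nth (A i k) s k) rowE.
rewrite (nth_map k) ?size_enum_ord // nth_ord_enum => ->.
by rewrite -tnth_nth !tnth_mktuple.
Qed.

Lemma sign_val_sqr (K : nzRingType) (s : sign) :
  sign_val K s * sign_val K s = 1.
Proof. by case: s; rewrite /= ?mulrNN mulr1. Qed.

Definition mx4 (K : nzRingType) (s : seq (seq K)) : 'M[K]_4 :=
  \matrix_(i < 4, j < 4) (nth [::] s i)`_j.

Lemma mxM_entries (K : nzRingType) (s : sign) (x z : K) :
  let w := sign_val K s - z in
  mxM s x z = mx4 [:: [:: x; - x; z; w]; [:: - x; x; w; z];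
                      [:: z; w; - x; x]; [:: w; z; x; - x]].
Proof.
move=> w; apply/matrixP => i j.
rewrite !mxE; case: splitP => i' ->; rewrite mxE; case: splitP => j' ->;
  rewrite !mxE; case: i' j' => [[|[|//]] ?] [[|[|//]] ?] //=; exact: opprK.
Qed.

(** Left multiplication by [mxF] swaps the rows of [mxB s z], which gives the lower right block. *)
Lemma mxN_entries (K : nzRingType) (s : sign) (x z : K) :
  let w := sign_val K s - z in
  mxN s z x = mx4 [:: [:: z; w; x; - x]; [:: w; z; - x; x];
                      [:: x; - x; w; z]; [:: - x; x; z; w]].
Proof.
move=> w; apply/matrixP => i j.
rewrite !mxE; case: splitP => i' ->; rewrite mxE; case: splitP => j' ->;
  rewrite !mxE ?big_ord_recl ?big_ord0 ?mxE;
  case: i' j' => [[|[|//]] ?] [[|[|//]] ?] //=;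
  by rewrite ?mul0r ?mul1r ?add0r ?addr0.
Qed.

(** With e the sign, each column has squared norm e^2 + 2(x^2 + z^2 - ez) = 1. Columns 1, 2 and
    columns 3, 4 have inner product 2(ez - z^2 - x^2) = 0; all other products cancel identically. *)
Lemma orthogonal_mxM (K : comNzRingType) (s : sign) (x z : K) :
  x ^+ 2 + z ^+ 2 = sign_val K s * z -> orthogonal_mx (mxM s x z).
Proof.
have := sign_val_sqr K s; rewrite /orthogonal_mx mxM_entries.
(* The relation is solved for [x ^+ 2] so that [ring] can use it as a rewrite rule on a monomial. *)
move: (sign_val K s) => e esqr xz; have {}xz : x ^+ 2 = e * z - z ^+ 2.
  by rewrite -xz addrK.
apply/matrixP => -[[|[|[|[|//]]]] ?] [[|[|[|[|//]]]] ?];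
  rewrite !mxE !big_ord_recl big_ord0 !mxE /=; ring: esqr xz.
Qed.

Lemma orthogonal_mxN (K : comNzRingType) (s : sign) (x z : K) :
  x ^+ 2 + z ^+ 2 = sign_val K s * z -> orthogonal_mx (mxN s z x).
Proof.
have := sign_val_sqr K s; rewrite /orthogonal_mx mxN_entries.
move: (sign_val K s) => e esqr xz; have {}xz : x ^+ 2 = e * z - z ^+ 2.
  by rewrite -xz addrK.
apply/matrixP => -[[|[|[|[|//]]]] ?] [[|[|[|[|//]]]] ?];
  rewrite !mxE !big_ord_recl big_ord0 !mxE /=; ring: esqr xz.
Qed.

Lemma permutative_mxM (K : nzRingType) (s : sign) (x z : K) :
  permutative (mxM s x z).
Proof.
rewrite mxM_entries; apply: permutative_perm_eq.
(* Each row lists x, -x, z and e - z in some order, so any predicate [P] has the same count on all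
   rows. *)
case=> [[|[|[|[|//]]]] ?] [[|[|[|[|//]]]] ?]; apply/seq.permP => P /=;
  rewrite !enum_ordSl enum_ord0 /= !mxE /=; lia.
Qed.

Lemma permutative_mxN (K : nzRingType) (s : sign) (x z : K) :
  permutative (mxN s z x).
Proof.
rewrite mxN_entries; apply: permutative_perm_eq.
case=> [[|[|[|[|//]]]] ?] [[|[|[|[|//]]]] ?]; apply/seq.permP => P /=;
  rewrite !enum_ordSl enum_ord0 /= !mxE /=; lia.
Qed.

Lemma real_mxM (C : numDomainType) (s : sign) (x z : C) :
  real_mx (mxM s x z) <-> x \is Num.real /\ z \is Num.real.
Proof.
rewrite mxM_entries; split=> [rM | [rx rz]].
  (* The first row already contains both x and z. *)
  by have := rM 0 0; have := rM 0 (inord 2); rewrite !mxE inordK.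
have re : sign_val C s \is Num.real by case: s; rewrite /= ?realN real1.
case=> [[|[|[|[|//]]]] ?] [[|[|[|[|//]]]] ?];
  by rewrite mxE /= ?realN ?realB.
Qed.

Lemma real_mxN (C : numDomainType) (s : sign) (x z : C) :
  real_mx (mxN s z x) <-> x \is Num.real /\ z \is Num.real.
Proof.
rewrite mxN_entries; split=> [rN | [rx rz]].
  by have := rN 0 (inord 2); have := rN 0 0; rewrite !mxE inordK.
have re : sign_val C s \is Num.real by case: s; rewrite /= ?realN real1.
case=> [[|[|[|[|//]]]] ?] [[|[|[|[|//]]]] ?];
  by rewrite mxE /= ?realN ?realB.
Qed.

Lemma one_oplus_P3_perm (K : nzRingType) (Q : 'M[K]_4) :
  one_oplus_P3 Q -> exists p : 'S_4, Q = perm_mx p.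
Proof.
by case=> _ /is_perm_mxP [t ->] ->; exists (lift0_perm t); exact: lift0_mx_perm.
Qed.

(** The root of a^2 is |a|, so the sign of a decides the case. *)
Lemma sqr_eq_sqrtr (R : rcfType) (a b : R) :
  a ^+ 2 = b -> a = Num.sqrt b \/ a = - Num.sqrt b.
Proof.
move=> <-; rewrite sqrtr_sqr.
by case: (ger0P a) => _; [left | right; rewrite opprK].
Qed.

Theorem corollary2p6 (R : realType) (s : sign) (x z : R[i])
    (Pbar A : 'M[R[i]]_4)
    (hxz : match s with
           | Plus => x ^+ 2 + z ^+ 2 - z = 0
           | Minus => x ^+ 2 + z ^+ 2 + z = 0
           end)
    (hP : one_oplus_P3 Pbar)
    (hA : A = Pbar *m mxM s x z
       \/ A = Pbar *m mxN s z x
       \/ A = Pbar *m P23 R[i] *m mxM s x z *m P23 R[i]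
       \/ A = Pbar *m P23 R[i] *m mxN s z x *m P23 R[i]
       \/ A = Pbar *m P24 R[i] *m mxM s x z *m P24 R[i]
       \/ A = Pbar *m P24 R[i] *m mxN s z x *m P24 R[i]) :
  [/\ real_mx A, orthogonal_mx A & permutative A] <->
  match s with
  | Plus => exists r : R, [/\ z = r%:C, 0 <= r <= 1
      & x = (Num.sqrt (r * (1 - r)))%:C \/ x = - (Num.sqrt (r * (1 - r)))%:C]
  | Minus => exists r : R, [/\ z = r%:C, -1 <= r <= 0
      & x = (Num.sqrt (- r * (1 + r)))%:C \/ x = - (Num.sqrt (- r * (1 + r)))%:C]
  end.
Proof.
have xz : x ^+ 2 + z ^+ 2 = sign_val R[i] s * z.
  case: s hxz {hA} => /= e0; apply/eqP; rewrite -subr_eq0.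
    by rewrite mul1r e0.
  by rewrite mulN1r opprK e0.
(* All six shapes are brought to one form, with [B] either [mxM s x z] or [mxN s z x]; [q] is the
   identity when there is no right factor. *)
have [p [q [B [-> [realB orthB permB]]]]] : exists p q : 'S_4, exists B,
    A = perm_mx p *m B *m perm_mx q /\
    [/\ real_mx B <-> x \is Num.real /\ z \is Num.real,
        orthogonal_mx B & permutative B].
  have propM := And3 (real_mxM s x z) (orthogonal_mxM xz)
                     (permutative_mxM s x z).
  have propN := And3 (real_mxN s x z) (orthogonal_mxN xz)
                     (permutative_mxN s x z).
  have [p PE] := one_oplus_P3_perm hP; rewrite PE in hA.
  move: hA; rewrite /P23 /P24 -!perm_mxM => -[|[|[|[|[|]]]]] ->.
  - by exists p, 1%g, (mxM s x z); rewrite perm_mx1 mulmx1.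
  - by exists p, 1%g, (mxN s z x); rewrite perm_mx1 mulmx1.
  - by eexists _, _, (mxM s x z).
  - by eexists _, _, (mxN s z x).
  - by eexists _, _, (mxM s x z).
  - by eexists _, _, (mxN s z x).
apply: (@iff_trans _ (x \is Num.real /\ z \is Num.real)).
  split=> [[/real_mx_perm /realB //] | /realB rB].
  split; first exact/real_mx_perm.
    exact: orthogonal_mx_perm.
  exact: permutative_perm.
(* The converse comes first: the displayed values of x and z are images of elements of [R], hence
   real. *)
split=> [[/complex_realP [a xE] /complex_realP [r zE]] |]; last first.
  by case: (s) => -[r [-> _ [] ->]]; rewrite ?realN; split;
    apply/complex_realP; eexists.
move: hxz; rewrite xE zE; case: (s) => hxz; exists r.
  have ar : a ^+ 2 = r * (1 - r).
    (* The complex relation descends to [R] because the embedding is injective. *)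
    apply/eqP; rewrite -subr_eq0 -(inj_eq (@complexI R)) rmorph0 -hxz.
    rewrite !(rmorphXn, rmorphB, rmorphM, rmorph1) /=; apply/eqP; ring.
  have a2_ge0 := sqr_ge0 a.
  (* The bounds follow from r(1 - r) = a^2 >= 0. *)
  split=> //; first by apply/andP; split; nra.
  by case: (sqr_eq_sqrtr ar) => ->; [left | right; rewrite rmorphN].
have ar : a ^+ 2 = - r * (1 + r).
  apply/eqP; rewrite -subr_eq0 -(inj_eq (@complexI R)) rmorph0 -hxz.
  rewrite !(rmorphXn, rmorphB, rmorphN, rmorphD, rmorphM, rmorph1) /=.
  apply/eqP; ring.
have a2_ge0 := sqr_ge0 a.
(* Here -r(1 + r) = a^2 >= 0 forces r into [-1, 0]. *)
split=> //; first by apply/andP; split; nra.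
by case: (sqr_eq_sqrtr ar) => ->; [left | right; rewrite rmorphN].
Qed.
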